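(* Let $[\mu]\in\mathcal A_n$ be a critical point of $F_n$ with $\mathrm M_\mu=c_\mu I+D_\mu$, $c_\mu\in\mathbb R$, $D_\mu\in\mathrm{Der}(\mu)$. Consider the orthogonal decomposition $\mathbb C^n=\mathfrak A_-\oplus\mathfrak A_0\oplus\mathfrak A_+$, where $\mathfrak A_-$, $\mathfrak A_0$, $\mathfrak A_+$ are the sums of eigenspaces of the Hermitian operator $D_\mu$ for eigenvalues $<0$, $=0$, $>0$ respectively. Then: (i) $\mathrm{ann}(\mu)\subset\mathfrak A_+$; (ii) $\mathfrak A_+\subset N(\mu)$; (iii) $\mathfrak A_-\subset C(\mu)\cap N(\mu)$ and $\mathfrak A_-\cap\mathrm{ann}(\mu)=0$; (iv) $(L^\mu_A-R^\mu_A)^*\in\mathrm{Der}(\mu)$ for every $A\in\mathfrak A_0$; consequently the Lie algebra $(\mathfrak A_0,[A,B]=\mu(A,B)-\mu(B,A))$ is reductive.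
   Context: $V_n$ is the space of bilinear maps $\mu:\mathbb C^n\times\mathbb C^n\to\mathbb C^n$ with standard Hermitian structures; $\mathcal A_n\subset\mathbb PV_n$ is the projectivization of the set of associative $\mu$, and a critical point of $F_n$ on $\mathcal A_n$ is a point of $\mathcal A_n$ that is a critical point of $F_n$ on $\mathbb PV_n$. $L^\mu_XY=\mu(X,Y)$, $R^\mu_XY=\mu(Y,X)$, $\mathrm M_\mu=2\sum_i L^\mu_{X_i}(L^\mu_{X_i})^*-2\sum_i (L^\mu_{X_i})^*L^\mu_{X_i}-2\sum_i (R^\mu_{X_i})^*R^\mu_{X_i}$ ($\{X_i\}$ orthonormal), $F_n([\mu])=\operatorname{tr}\mathrm M_\mu^2/\|\mu\|^4$; $[\mu]$ is critical iff $\mathrm M_\mu=c_\mu I+D_\mu$ with $c_\mu\in\mathbb R$, $D_\mu$ a derivation. For the associative algebra $\mu$: $C(\mu)=\{x:\mu(x,y)=\mu(y,x)\ \forall y\}$ (center), $\mathrm{ann}(\mu)=\{x:\mu(x,y)=\mu(y,x)=0\ \forall y\}$ (annihilator), and $N(\mu)$ is the radical, the largest nilpotent ideal. *)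

(* Defs.v *)
(* Scalars: an arbitrary numeric algebraically closed field C
   (C = the complex numbers is an instance). Vectors of C^n are column vectors
   'cV[C]_n, operators are n x n matrices acting by A *m v. *)
From mathcomp Require Import all_boot all_order all_algebra.
Set Implicit Arguments. Unset Strict Implicit. Unset Printing Implicit Defensive.
Import Order.TTheory GRing.Theory Num.Theory.
Local Open Scope ring_scope.

Section Defs.
Variables (C : numClosedFieldType) (n : nat).

Local Notation vec := 'cV[C]_n.

(* A bilinear map C^n x C^n -> C^n, given by its values on the standard basis. *)
Definition bilin := 'I_n -> 'I_n -> vec.

Definition evec (j : 'I_n) : vec := delta_mx j 0.

Definition bmul (mu : bilin) (x y : vec) : vec :=
  \sum_(i < n) \sum_(j < n) (x i 0 * y j 0) *: mu i j.

Definition bilin_nonzero (mu : bilin) : Prop := exists i j, mu i j != 0.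

Definition Lop (mu : bilin) (X : vec) : 'M[C]_n :=
  \matrix_(k, j) (bmul mu X (evec j)) k 0.
Definition Rop (mu : bilin) (X : vec) : 'M[C]_n :=
  \matrix_(k, j) (bmul mu (evec j) X) k 0.

Definition adjm (A : 'M[C]_n) : 'M[C]_n := (map_mx Num.conj A)^T.

Definition Mmu (mu : bilin) : 'M[C]_n :=
  2%:R *: (\sum_(i < n) Lop mu (evec i) *m adjm (Lop mu (evec i)))
  - 2%:R *: (\sum_(i < n) adjm (Lop mu (evec i)) *m Lop mu (evec i))
  - 2%:R *: (\sum_(i < n) adjm (Rop mu (evec i)) *m Rop mu (evec i)).

Definition associative_bilin (mu : bilin) : Prop :=
  forall x y z, bmul mu (bmul mu x y) z = bmul mu x (bmul mu y z).

Definition is_derivation (mu : bilin) (D : 'M[C]_n) : Prop :=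
  forall x y, D *m bmul mu x y = bmul mu (D *m x) y + bmul mu x (D *m y).

Definition eigsum (D : 'M[C]_n) (P : C -> Prop) (v : vec) : Prop :=
  exists (k : nat) (a : 'I_k -> C) (w : 'I_k -> vec),
    (forall i, P (a i) /\ D *m w i = a i *: w i) /\ v = \sum_(i < k) w i.

Definition Aminus (D : 'M[C]_n) := eigsum D (fun a => a < 0).
Definition Azero (D : 'M[C]_n) := eigsum D (fun a => a = 0).
Definition Aplus (D : 'M[C]_n) := eigsum D (fun a => 0 < a).

Definition in_center (mu : bilin) (x : vec) : Prop :=
  forall y, bmul mu x y = bmul mu y x.
Definition in_ann (mu : bilin) (x : vec) : Prop :=
  forall y, bmul mu x y = 0 /\ bmul mu y x = 0.

Definition subspace (P : vec -> Prop) : Prop :=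
  [/\ P 0, (forall x y, P x -> P y -> P (x + y)) & (forall (a : C) x, P x -> P (a *: x))].

Definition ideal (mu : bilin) (I : vec -> Prop) : Prop :=
  subspace I /\ forall x y, I y -> I (bmul mu x y) /\ I (bmul mu y x).

Definition nilpotent_ideal (mu : bilin) (I : vec -> Prop) : Prop :=
  ideal mu I /\
  exists m : nat, forall (x : vec) (s : seq vec),
    size s = m -> I x -> (forall y, y \in s -> I y) -> foldl (bmul mu) x s = 0.

Definition is_radical (mu : bilin) (N : vec -> Prop) : Prop :=
  nilpotent_ideal mu N /\
  forall J, nilpotent_ideal mu J -> forall x, J x -> N x.

Definition lie (mu : bilin) (x y : vec) : vec := bmul mu x y - bmul mu y x.

Definition lie_ideal (br : vec -> vec -> vec) (g I : vec -> Prop) : Prop :=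
  [/\ subspace I, (forall x, I x -> g x) & (forall a x, g a -> I x -> I (br a x))].

(* (g, br) is a reductive Lie algebra: g is a subspace closed under the bracket,
   and its adjoint representation is completely reducible, i.e. every ideal
   has a complementary ideal. *)
Definition reductive_lie (br : vec -> vec -> vec) (g : vec -> Prop) : Prop :=
  [/\ subspace g, (forall a b, g a -> g b -> g (br a b)) &
    forall I, lie_ideal br g I ->
      exists J, [/\ lie_ideal br g J,
                   (forall v, I v -> J v -> v = 0) &
                   (forall v, g v -> exists x y, [/\ I x, J y & v = x + y])]].

End Defs.

(* Main.v *)
(* Write [M] for [Mmu mu].  The moment map identity [tr (M B) = 2 <pi(B) mu, mu>] gives,
   for a derivation [A] with [[D, A] = l A], that [l |A|^2 = 2 |pi(A^H) mu|^2].
   Applied to the inner derivations [ad_x = L_x - R_x], with [D x = l x]: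
   for [l < 0], [ad_x = 0] and [x] is central; for [l = 0], [ad_x^H] is a derivation.
   On the annihilator [x^H M x >= 0] while [c < 0], so [D] is positive there.
   [A+] and [A-] lie in the nilpotent ideal spanned by [A+] and the ideal generated
   by the central space [A-].  An ideal of the Lie algebra [A0] has an
   [ad]-invariant orthogonal complement, because [ad_a^H] is a derivation. *)
Require Import Defs.
From mathcomp Require Import all_boot all_order all_algebra.
From mathcomp Require Import ring zify.
From Stdlib Require Import Classical.
Set Implicit Arguments. Unset Strict Implicit. Unset Printing Implicit Defensive.
Import Order.TTheory GRing.Theory Num.Theory.
Local Open Scope ring_scope.

(** * Conjugate transpose and the Frobenius norm *)

Section ConjugateTranspose.
Variable C : numClosedFieldType.

(** Rectangular, unlike [adjm], so that [x^H *m y] is the inner product of two columns. *)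
Definition ctmx (m p : nat) (A : 'M[C]_(m, p)) : 'M[C]_(p, m) :=
  (map_mx Num.conj A)^T.

Local Notation "A ^H" := (ctmx A) (at level 8, format "A ^H").

Lemma adjmE n (A : 'M[C]_n) : adjm A = A^H.
Proof. by []. Qed.

Lemma ctmxE m p (A : 'M[C]_(m, p)) i j : A^H i j = (A j i)^*.
Proof. by rewrite !mxE. Qed.

Lemma ctmxK m p (A : 'M[C]_(m, p)) : A^H^H = A.
Proof. by apply/matrixP => i j; rewrite !ctmxE conjCK. Qed.

Lemma ctmx0 m p : (0 : 'M[C]_(m, p))^H = 0.
Proof. by apply/matrixP => i j; rewrite ctmxE !mxE conjC0. Qed.

Lemma ctmxD m p (A B : 'M[C]_(m, p)) : (A + B)^H = A^H + B^H.
Proof. by rewrite /ctmx map_mxD linearD. Qed.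

Lemma ctmxN m p (A : 'M[C]_(m, p)) : (- A)^H = - A^H.
Proof. by rewrite /ctmx map_mxN linearN. Qed.

Lemma ctmxB m p (A B : 'M[C]_(m, p)) : (A - B)^H = A^H - B^H.
Proof. by rewrite ctmxD ctmxN. Qed.

Lemma ctmxZ m p a (A : 'M[C]_(m, p)) : (a *: A)^H = a^* *: A^H.
Proof. by rewrite /ctmx map_mxZ linearZ. Qed.

Lemma ctmx_sum m p (I : Type) (r : seq I) (F : I -> 'M[C]_(m, p)) :
  (\sum_(i <- r) F i)^H = \sum_(i <- r) (F i)^H.
Proof.
by elim/big_rec2: _ => [|i _ y _ <-]; rewrite ?ctmx0 // ctmxD.
Qed.

Lemma ctmxM m p q (A : 'M[C]_(m, p)) (B : 'M[C]_(p, q)) :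
  (A *m B)^H = B^H *m A^H.
Proof. by rewrite /ctmx map_mxM trmx_mul. Qed.

Lemma ctmx_scalar n (a : C) : (a%:M : 'M_n)^H = (a^*)%:M.
Proof. by rewrite /ctmx map_scalar_mx tr_scalar_mx. Qed.

Lemma mxtrace_mul_ctmx m p (A : 'M[C]_(m, p)) :
  \tr (A *m A^H) = \sum_i \sum_j `|A i j| ^+ 2.
Proof.
apply: eq_bigr => i _; rewrite mxE; apply: eq_bigr => j _.
by rewrite ctmxE normCK.
Qed.

Lemma mxtrace_mul_ctmx_ge0 m p (A : 'M[C]_(m, p)) : 0 <= \tr (A *m A^H).
Proof.
rewrite mxtrace_mul_ctmx; apply: sumr_ge0 => i _; apply: sumr_ge0 => j _.
exact: exprn_ge0.
Qed.

Lemma mxtrace_mul_ctmx_eq0 m p (A : 'M[C]_(m, p)) :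
  \tr (A *m A^H) = 0 -> A = 0.
Proof.
have nneg i j : 0 <= `|A i j| ^+ 2 by exact: exprn_ge0.
rewrite mxtrace_mul_ctmx => A0; apply/matrixP => i j.
have Ai : \sum_j `|A i j| ^+ 2 = 0.
  by apply: (psumr_eq0P _ A0) => // k _; apply: sumr_ge0.
have /eqP : `|A i j| ^+ 2 = 0 by apply: (psumr_eq0P _ Ai).
by rewrite expf_eq0 normr_eq0 mxE /= => /eqP.
Qed.

Lemma ctmx_mul_eq0 m p (A : 'M[C]_(m, p)) : A^H *m A = 0 -> A = 0.
Proof.
move=> A0; apply: mxtrace_mul_ctmx_eq0.
by rewrite mxtrace_mulC A0 mxtrace0.
Qed.

End ConjugateTranspose.

Local Notation "A ^H" := (ctmx A) (at level 8, format "A ^H").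

(** * Bilinearity and multiplication operators *)

Section Algebra.
Variables (C : numClosedFieldType) (n : nat) (mu : bilin C n).
Local Notation vec := 'cV[C]_n.

Lemma bmulDl (x y z : vec) : bmul mu (x + y) z = bmul mu x z + bmul mu y z.
Proof.
rewrite /bmul -big_split; apply: eq_bigr => i _ /=; rewrite -big_split.
by apply: eq_bigr => j _; rewrite mxE mulrDl scalerDl.
Qed.

Lemma bmulDr (x y z : vec) : bmul mu x (y + z) = bmul mu x y + bmul mu x z.
Proof.
rewrite /bmul -big_split; apply: eq_bigr => i _ /=; rewrite -big_split.
by apply: eq_bigr => j _; rewrite mxE mulrDr scalerDl.
Qed.

Lemma bmulZl a (x y : vec) : bmul mu (a *: x) y = a *: bmul mu x y.
Proof.
rewrite /bmul scaler_sumr; apply: eq_bigr => i _; rewrite scaler_sumr.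
by apply: eq_bigr => j _; rewrite mxE scalerA mulrA.
Qed.

Lemma bmulZr a (x y : vec) : bmul mu x (a *: y) = a *: bmul mu x y.
Proof.
rewrite /bmul scaler_sumr; apply: eq_bigr => i _; rewrite scaler_sumr.
by apply: eq_bigr => j _; rewrite mxE scalerA mulrCA.
Qed.

Lemma bmul0l (y : vec) : bmul mu 0 y = 0.
Proof. by have := bmulZl 0 0 y; rewrite !scale0r. Qed.

Lemma bmul0r (x : vec) : bmul mu x 0 = 0.
Proof. by have := bmulZr 0 x 0; rewrite !scale0r. Qed.

Lemma bmul_suml (I : Type) (r : seq I) (F : I -> vec) (y : vec) :
  bmul mu (\sum_(i <- r) F i) y = \sum_(i <- r) bmul mu (F i) y.
Proof. exact: (big_morph (bmul mu ^~ y) (fun u v => bmulDl u v y) (bmul0l y)). Qed.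

Lemma bmul_sumr (I : Type) (r : seq I) (F : I -> vec) (x : vec) :
  bmul mu x (\sum_(i <- r) F i) = \sum_(i <- r) bmul mu x (F i).
Proof. exact: (big_morph (bmul mu x) (bmulDr x) (bmul0r x)). Qed.

Lemma vec_sum_evec (x : vec) : x = \sum_i x i 0 *: evec C i.
Proof.
apply/colP => k; rewrite summxE (bigD1 k) //= big1 ?addr0 => [|i ik].
  by rewrite !mxE !eqxx mulr1.
by rewrite !mxE eq_sym (negbTE ik) mulr0.
Qed.

Lemma Lop_mul (x y : vec) : Lop mu x *m y = bmul mu x y.
Proof.
rewrite [in RHS](vec_sum_evec y) bmul_sumr; apply/colP => k.
rewrite mxE summxE; apply: eq_bigr => j _.
by rewrite bmulZr !mxE mulrC.
Qed.

Lemma Rop_mul (x y : vec) : Rop mu x *m y = bmul mu y x.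
Proof.
rewrite [in RHS](vec_sum_evec y) bmul_suml; apply/colP => k.
rewrite mxE summxE; apply: eq_bigr => j _.
by rewrite bmulZl !mxE mulrC.
Qed.

Lemma mulmx_evec (A : 'M[C]_n) i : A *m evec C i = \sum_k A k i *: evec C k.
Proof.
rewrite [LHS]vec_sum_evec; apply: eq_bigr => k _.
by rewrite /evec -colE mxE.
Qed.

Lemma eqmx_mulvec (A B : 'M[C]_n) : (forall v : vec, A *m v = B *m v) -> A = B.
Proof.
move=> AB; apply/matrixP => i j; have := AB (evec C j).
by rewrite -!colE => /colP/(_ i); rewrite !mxE.
Qed.

Lemma LopZ a (x : vec) : Lop mu (a *: x) = a *: Lop mu x.
Proof. by apply: eqmx_mulvec => v; rewrite -scalemxAl !Lop_mul bmulZl. Qed.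

Lemma Lop_sumE (I : Type) (r : seq I) (F : I -> vec) :
  Lop mu (\sum_(i <- r) F i) = \sum_(i <- r) Lop mu (F i).
Proof.
apply: eqmx_mulvec => v; rewrite Lop_mul mulmx_suml bmul_suml.
by apply: eq_bigr => i _; rewrite Lop_mul.
Qed.

Lemma Lop_sum (x : vec) : Lop mu x = \sum_i x i 0 *: Lop mu (evec C i).
Proof. by rewrite {1}(vec_sum_evec x) Lop_sumE; apply: eq_bigr => i _; rewrite LopZ. Qed.

Lemma mulmx_evec_Lop (A : 'M[C]_n) i :
  Lop mu (A *m evec C i) = \sum_k A k i *: Lop mu (evec C k).
Proof. by rewrite mulmx_evec Lop_sumE; apply: eq_bigr => k _; rewrite LopZ. Qed.

(** * The infinitesimal action and the moment map identity *)

(* The infinitesimal action [pi(A) mu (x, y) = A mu(x, y) - mu(A x, y) - mu(x, A y)],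
   on a bilinear map given by its left multiplications [S i] by basis vectors. *)
Definition gl_act (A : 'M[C]_n) (S : 'I_n -> 'M[C]_n) (i : 'I_n) : 'M[C]_n :=
  A *m S i - S i *m A - \sum_k A k i *: S k.

(** The standard Hermitian product on bilinear maps, read off their left multiplications by basis
    vectors. *)
Definition hdot (S T : 'I_n -> 'M[C]_n) : C := \sum_i \tr (S i *m (T i)^H).

Local Notation L := (fun i => Lop mu (evec C i)).

(** The first two terms pass to the other side by cyclicity of the trace, the index sum by
    exchanging [i] and [k]. *)
Lemma gl_act_adjoint A S T : hdot (gl_act A S) T = hdot S (gl_act A^H T).
Proof.
rewrite /hdot /gl_act.
under eq_bigr do rewrite !mulmxBl !linearB /= mulmx_suml linear_sum /=.
under [RHS]eq_bigr do
  rewrite !ctmxB !ctmxM ctmxK !mulmxBr !linearB /= ctmx_sum mulmx_sumr linear_sum /=.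
rewrite !sumrB; congr (_ - _ - _).
- by apply: eq_bigr => i _; rewrite -mulmxA mxtrace_mulC mulmxA.
- by apply: eq_bigr => i _; rewrite mulmxA.
rewrite exchange_big; apply: eq_bigr => i _; apply: eq_bigr => k _ /=.
by rewrite -scalemxAl ctmxZ -scalemxAr ctmxE conjCK.
Qed.

(** The three terms of the action commute with one another for different matrices, so only the
    commutator of each term with itself survives. *)
Lemma gl_act_bracket A B S i :
  gl_act A (gl_act B S) i - gl_act B (gl_act A S) i =
  gl_act (A *m B - B *m A) S i.
Proof.
have outer (P Q : 'M[C]_n) :
    \sum_k P k i *: gl_act Q S k =
    Q *m (\sum_k P k i *: S k) - (\sum_k P k i *: S k) *m Q -
    \sum_k (Q *m P) k i *: S k.
  rewrite /gl_act mulmx_sumr mulmx_suml.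
  under eq_bigr do rewrite !scalerBr scaler_sumr.
  rewrite !sumrB; congr (_ - _ - _).
  - by apply: eq_bigr => k _; rewrite scalemxAr.
  - by apply: eq_bigr => k _; rewrite scalemxAl.
  rewrite exchange_big; apply: eq_bigr => l _ /=.
  rewrite mxE scaler_suml; apply: eq_bigr => k _.
  by rewrite scalerA mulrC.
have split : \sum_k (A *m B - B *m A) k i *: S k =
    \sum_k (A *m B) k i *: S k - \sum_k (B *m A) k i *: S k.
  by rewrite -sumrB; apply: eq_bigr => k _; rewrite mxE [X in _ + X]mxE scalerBl.
rewrite {1 3 5}/gl_act !outer split /gl_act.
move: (\sum_k A k i *: S k) (\sum_k B k i *: S k) => a b.
move: (\sum_k _ *: S k) (\sum_k _ *: S k) => ab ba.
rewrite !(mulmxBl, mulmxBr) !mulmxA.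
(* With all products expanded, each matrix monomial is an atom, so entrywise the identity is
   additive and [ring] decides it. *)
apply/matrixP => k l.
have entryD (X Y : 'M[C]_n) : (X + Y) k l = X k l + Y k l by rewrite mxE.
have entryN (X : 'M[C]_n) : (- X) k l = - X k l by rewrite mxE.
by rewrite !(entryD, entryN); ring.
Qed.

Lemma gl_act0 A S : (forall i, S i = 0) -> forall i, gl_act A S i = 0.
Proof.
move=> S0 i; rewrite /gl_act S0 mulmx0 mul0mx big1 ?subr0 // => k _.
by rewrite S0 scaler0.
Qed.

Lemma hdot_ge0 S : 0 <= hdot S S.
Proof. by apply: sumr_ge0 => i _; apply: mxtrace_mul_ctmx_ge0. Qed.

Lemma hdot_eq0 S : hdot S S = 0 -> forall i, S i = 0.
Proof.
move=> S0 i; apply: mxtrace_mul_ctmx_eq0.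
by apply: (psumr_eq0P _ S0) => // k _; apply: mxtrace_mul_ctmx_ge0.
Qed.

Lemma eq_hdot S S' T T' : S =1 S' -> T =1 T' -> hdot S T = hdot S' T'.
Proof. by move=> eS eT; apply: eq_bigr => i _; rewrite eS eT. Qed.

(** Derivations form the stabilizer of [mu] under the action; basis vectors in the left argument
    suffice by linearity. *)
Lemma derivationP A :
  is_derivation mu A <-> forall i, gl_act A L i = 0.
Proof.
rewrite /is_derivation; split=> [derA i | A0 x y].
  apply: eqmx_mulvec => v; rewrite mul0mx /gl_act -mulmx_evec_Lop.
  rewrite !mulmxBl -!mulmxA !Lop_mul derA.
  by rewrite addrK subrr.
have Lx : A *m Lop mu x = Lop mu x *m A + Lop mu (A *m x).
  rewrite Lop_sum mulmx_sumr mulmx_suml.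
  rewrite [in Lop mu (A *m x)](vec_sum_evec x) mulmx_sumr Lop_sumE -big_split.
  apply: eq_bigr => i _ /=; have /eqP := A0 i.
  rewrite /gl_act -mulmx_evec_Lop subr_eq0 subr_eq addrC => /eqP AL.
  by rewrite -scalemxAr AL -!scalemxAr -scalemxAl LopZ scalerDr.
by rewrite -Lop_mul mulmxA Lx mulmxDl -mulmxA !Lop_mul addrC.
Qed.

(** The moment map identity: the three sums in [Mmu] match the three terms of the action. *)
Lemma mxtrace_Mmu A : \tr (Mmu mu *m A) = 2 * hdot (gl_act A L) L.
Proof.
rewrite /Mmu !mulmxBl -!scalemxAl !linearB !linearZ /= -!mulrBr; congr (_ * _).
rewrite !mulmx_suml !linear_sum /= -!sumrB /hdot.
under [RHS]eq_bigr do rewrite /gl_act !mulmxBl !linearB /= mulmx_suml linear_sum /=.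
rewrite !sumrB; congr (_ - _ - _).
- by apply: eq_bigr => i _; rewrite mxtrace_mulC mulmxA.
- by apply: eq_bigr => i _; rewrite -mulmxA mxtrace_mulC.
(* The left side uses right multiplications and [hdot] left ones, so both are written in structure
   constants and the sums reordered. *)
transitivity (\sum_q \sum_i \sum_k \sum_p
    A k i * (Rop mu (evec C q) p k * (Rop mu (evec C q) p i)^*)).
  apply: eq_bigr => q _; apply: eq_bigr => i _; rewrite mxE.
  apply: eq_bigr => k _; rewrite mxE mulr_suml; apply: eq_bigr => p _.
  by rewrite adjmE ctmxE mulrC [_^* * _]mulrC.
rewrite exchange_big; apply: eq_bigr => i _ /=.
rewrite exchange_big; apply: eq_bigr => k _ /=.
rewrite exchange_big -scalemxAl linearZ /= /mxtrace mulr_sumr.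
apply: eq_bigr => p _ /=; rewrite mxE mulr_sumr; apply: eq_bigr => q _.
by rewrite ctmxE !mxE.
Qed.

(** Since [A] kills [mu], moving one [A^H] across the product gives the action of [[A, A^H]] on [mu]
    paired with [mu]. This is half of [tr (M [A, A^H])], to which the scalar part of [M] contributes
    nothing. *)
Lemma derivation_ctmx (A D : 'M[C]_n) (c : C) :
  is_derivation mu A -> Mmu mu = c%:M + D ->
  2 * hdot (gl_act A^H L) (gl_act A^H L) = \tr ((D *m A - A *m D) *m A^H).
Proof.
move=> /derivationP A0 Mc.
have -> : hdot (gl_act A^H L) (gl_act A^H L) =
    hdot (gl_act (A *m A^H - A^H *m A) L) L.
  rewrite -gl_act_adjoint; apply: eq_hdot => // i.
  by rewrite -gl_act_bracket [X in _ - X]gl_act0 ?subr0.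
rewrite -mxtrace_Mmu Mc [_ *m (_ - _)]mulmxDl mul_scalar_mx linearD linearZ /=.
rewrite linearB /= [\tr (A^H *m A)]mxtrace_mulC subrr mulr0 add0r.
rewrite mulmxBr mulmxBl !linearB /= !mulmxA; congr (_ - _).
by rewrite [RHS]mxtrace_mulC mulmxA mxtrace_mulC mulmxA mxtrace_mulC mulmxA.
Qed.

Lemma eigen_derivation (A D : 'M[C]_n) (c l : C) :
  is_derivation mu A -> Mmu mu = c%:M + D -> D *m A - A *m D = l *: A ->
  [/\ 0 <= l * \tr (A *m A^H) & l = 0 -> is_derivation mu A^H].
Proof.
move=> derA Mc lA; have := derivation_ctmx derA Mc.
rewrite lA -scalemxAl linearZ /= => key; split.
  by rewrite -key mulr_ge0 ?hdot_ge0.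
move=> l0; apply/derivationP; apply: hdot_eq0.
move/eqP: key; rewrite l0 mul0r mulf_eq0 pnatr_eq0 /=.
by move/eqP.
Qed.

Lemma Mmu_hermitian : (Mmu mu)^H = Mmu mu.
Proof.
rewrite /Mmu !ctmxB !ctmxZ !ctmx_sum conjC_nat.
by do !congr (_ - _); congr (_ *: _); apply: eq_bigr => i _;
  rewrite ctmxM adjmE ctmxK.
Qed.

(** The identity acts on [mu] by [-1], so [tr M = -2 |mu|^2 < 0]; and [tr (M D) = 0] because [D]
    kills [mu], so [tr (M^2) = c tr M]. As [M] is Hermitian and nonzero, [tr (M^2) > 0]. *)
Lemma Mmu_scalar_lt0 (c : C) (D : 'M[C]_n) :
  bilin_nonzero mu -> is_derivation mu D -> Mmu mu = c%:M + D -> c < 0.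
Proof.
move=> [i [j mu_ij]] /derivationP D0 Mc.
have L_gt0 : 0 < hdot L L.
  rewrite lt_def hdot_ge0 andbT; apply: contra_neq mu_ij => /hdot_eq0/(_ i) Li0.
  have := Lop_mul (evec C i) (evec C j).
  rewrite Li0 mul0mx /bmul (bigD1 i) //= (bigD1 j) //= !big1 ?addr0.
  - by rewrite !mxE !eqxx mulr1 scale1r.
  - by move=> k ki; rewrite big1 // => l _; rewrite !mxE (negbTE ki) mul0r scale0r.
  by move=> l lj; rewrite !mxE (negbTE lj) mulr0 scale0r.
have trM : \tr (Mmu mu) = - (2 * hdot L L).
  rewrite -[Mmu mu]mulmx1 mxtrace_Mmu -mulrN; congr (_ * _).
  rewrite /hdot -sumrN; apply: eq_bigr => k _.
  rewrite /gl_act mul1mx mulmx1 subrr sub0r mulNmx linearN /=; congr (- \tr (_ *m _)).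
  rewrite (bigD1 k) //= big1 ?addr0 => [|l lk]; rewrite mxE ?eqxx ?scale1r //.
  by rewrite (negbTE lk) scale0r.
have trM_lt0 : \tr (Mmu mu) < 0 by rewrite trM oppr_lt0 mulr_gt0.
have trMM : \tr (Mmu mu *m (Mmu mu)^H) = c * \tr (Mmu mu).
  rewrite Mmu_hermitian {2}Mc mulmxDr linearD /= mul_mx_scalar linearZ /=.
  rewrite mxtrace_Mmu [hdot _ _](_ : _ = 0) ?mulr0 ?addr0 //.
  by apply: big1 => k _; rewrite D0 mul0mx mxtrace0.
rewrite -(nmulr_lgt0 _ trM_lt0) -trMM lt_def mxtrace_mul_ctmx_ge0 andbT.
apply: contraTneq trM_lt0 => /mxtrace_mul_ctmx_eq0 ->.
by rewrite mxtrace0 ltxx.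
Qed.

(** * Inner derivations *)

Lemma Lop_bracket (D : 'M[C]_n) (x : vec) :
  is_derivation mu D -> D *m Lop mu x - Lop mu x *m D = Lop mu (D *m x).
Proof.
move=> derD; apply: eqmx_mulvec => v.
by rewrite mulmxBl -!mulmxA !Lop_mul derD addrK.
Qed.

Lemma Rop_bracket (D : 'M[C]_n) (x : vec) :
  is_derivation mu D -> D *m Rop mu x - Rop mu x *m D = Rop mu (D *m x).
Proof.
move=> derD; apply: eqmx_mulvec => v.
by rewrite mulmxBl -!mulmxA !Rop_mul derD [X in X - _]addrC addrK.
Qed.

Definition admx (x : vec) : 'M[C]_n := Lop mu x - Rop mu x.

Lemma admx_mul x y : admx x *m y = lie mu x y.
Proof. by rewrite mulmxBl Lop_mul Rop_mul. Qed.

Lemma admx_bracket (D : 'M[C]_n) (x : vec) :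
  is_derivation mu D -> D *m admx x - admx x *m D = admx (D *m x).
Proof.
move=> derD; rewrite /admx -Lop_bracket // -Rop_bracket //.
by rewrite mulmxBr mulmxBl !opprD !opprK addrACA.
Qed.

Lemma admx_derivation (x : vec) : associative_bilin mu -> is_derivation mu (admx x).
Proof.
move=> assoc y z; rewrite !admx_mul /lie.
have bN u v : bmul mu (- u) v = - bmul mu u v by rewrite -scaleN1r bmulZl scaleN1r.
have bNr u v : bmul mu u (- v) = - bmul mu u v by rewrite -scaleN1r bmulZr scaleN1r.
by rewrite bmulDl bmulDr bN bNr !assoc addrA subrK.
Qed.


(** * Eigencoordinates and the grading by eigenvalues of [D] *)

(** The entries of [U *m v] are the coordinates of [v] in an orthonormal eigenbasis, whose vectors
    are the columns of [U^H]. *)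
Definition diagonalizes (U : 'M[C]_n) (d : 'I_n -> C) (D : 'M[C]_n) : Prop :=
  [/\ U *m U^H = 1%:M, U^H *m U = 1%:M, (forall i, d i \is Num.real) &
      forall v i, (U *m (D *m v)) i 0 = d i * (U *m v : vec) i 0].

Lemma hermitian_diagonalizes (D : 'M[C]_n) : D^H = D ->
  exists U d, diagonalizes U d D.
Proof.
move=> hD; have ctE (A : 'M[C]_n) : map_mx Num.conj A^T = A^H by apply/matrixP => i j; rewrite !mxE.
have hermD : D \is hermsymmx.
  by rewrite is_hermitianmxE expr0 scale1r -{1}hD -ctE.
have /orthomx_spectralP := hermitian_normalmx hermD.
move: (spectral_unitarymx D) => Uunit.
move: (spectralmx D) (hermitian_spectral_diag_real hermD) Uunit => U.
move: (spectral_diag D) => e /mxOverP ereal.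
have := @unitarymxP C n n U; rewrite /= ctE => /elimT UP /[dup]/UP UU Uunit.
rewrite invmx_unitary // ctE => eD.
have UU' : U^H *m U = 1%:M by exact: mulmx1C.
exists U, (fun i => e 0 i); split=> // v i.
by rewrite eD !mulmxA UU mul1mx -mulmxA mul_diag_mx mxE.
Qed.

Lemma diagonalizes_opp U d D :
  diagonalizes U d D -> diagonalizes U (fun i => - d i) (- D).
Proof.
move=> [UU UU' dR UD]; split=> // [i|v i]; first by rewrite rpredN.
by rewrite mulNmx mulmxN mxE UD mulNr.
Qed.

Lemma neq0_sum (I : finType) (F : I -> C) :
  \sum_i F i != 0 -> exists i, F i != 0.
Proof.
move=> F0; apply/existsP; apply: contraNT F0 => /existsPn F0.
by rewrite big1 // => i _; apply/eqP; rewrite -[_ == _]negbK F0.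
Qed.

Lemma coord_inj U d D (x y : vec) : diagonalizes U d D ->
  (forall i, (U *m x) i 0 = (U *m y) i 0) -> x = y.
Proof.
move=> [_ UU' _ _] xy; rewrite -[x]mul1mx -[y]mul1mx -UU' -!mulmxA.
by congr (_ *m _); apply/colP => i; apply: xy.
Qed.

Lemma eigenvector_decomposition U d D (x : vec) : diagonalizes U d D ->
  x = \sum_i (U *m x) i 0 *: (U^H *m evec C i).
Proof.
move=> [_ UU' _ _]; rewrite -[LHS]mul1mx -UU' -mulmxA [in LHS](vec_sum_evec (U *m x)).
by rewrite mulmx_sumr; apply: eq_bigr => i _; rewrite scalemxAr.
Qed.

Lemma diagonalizes_eigen U d D i : diagonalizes U d D ->
  D *m (U^H *m evec C i) = d i *: (U^H *m evec C i).
Proof.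
move=> dD; have [UU _ _ UD] := dD; apply: (coord_inj dD) => k.
rewrite UD -scalemxAr [RHS]mxE !mulmxA UU !mul1mx !mxE.
by case: eqP => [->|]; rewrite ?mulr0.
Qed.

(** Membership in a sum of eigenspaces becomes a condition on the support in eigencoordinates, the
    form used from here on. *)
Lemma eigsumP U d D (P : C -> Prop) (v : vec) : diagonalizes U d D ->
  eigsum D P v <-> (forall i, (U *m v) i 0 != 0 -> P (d i)).
Proof.
move=> dD; have [UU UU' dR UD] := dD; split=> [[k [a [w [Pw ->]]]] i|Pv].
  rewrite mulmx_sumr summxE => /neq0_sum[j Uwj].
  have [Paj eij] := Pw j; have := UD (w j) i.
  by rewrite eij -scalemxAr mxE => /(mulIf Uwj) <-.
(* Only nonzero coordinates are listed, because [P] must hold at every listed eigenvalue. *)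
pose m := #|[pred i | (U *m v) i 0 != 0]|.
pose f (i : 'I_m) : 'I_n := enum_val i.
exists m, (d \o f), (fun i => (U *m v) (f i) 0 *: (U^H *m evec C (f i))); split=> [i|].
  split; first by apply: Pv; have := enum_valP i.
  by rewrite -scalemxAr (diagonalizes_eigen _ dD) scalerA mulrC scalerA.
rewrite [LHS](eigenvector_decomposition v dD).
rewrite (bigID [pred i | (U *m v) i 0 != 0]) /= addrC big1 ?add0r.
  by rewrite -(big_enum_val (fun i => (U *m v) i 0 *: (U^H *m evec C i))).
by move=> i; rewrite negbK => /eqP ->; rewrite scale0r.
Qed.

Lemma eigsum_subspace U d D P : diagonalizes U d D -> subspace (eigsum D P : vec -> Prop).
Proof.
move=> dD; split=> [|x y|a x].
- by apply/(eigsumP _ _ dD) => i; rewrite mulmx0 mxE eqxx.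
- move=> /(eigsumP _ _ dD) Px /(eigsumP _ _ dD) Py; apply/(eigsumP _ _ dD) => i.
  rewrite mulmxDr mxE; case: (eqVneq ((U *m x) i 0) 0) => [->|/Px //].
  by rewrite add0r; apply: Py.
move=> /(eigsumP _ _ dD) Px; apply/(eigsumP _ _ dD) => i.
by rewrite -scalemxAr mxE mulf_eq0 => /norP[_ /Px].
Qed.

(** A derivation grades the algebra: the product of eigenvectors for [d i] and [d j] has only
    components with eigenvalue [d i + d j]. *)
Lemma eigsum_mul U d D (P Q R : C -> Prop) (x y : vec) :
  diagonalizes U d D -> is_derivation mu D ->
  (forall i j l, P (d i) -> Q (d j) -> d l = d i + d j -> R (d l)) ->
  eigsum D P x -> eigsum D Q y -> eigsum D R (bmul mu x y).
Proof.
move=> dD derD PQR /(eigsumP _ _ dD) Px /(eigsumP _ _ dD) Qy.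
have [_ _ _ UD] := dD; apply/(eigsumP _ _ dD) => l.
rewrite (eigenvector_decomposition x dD) bmul_suml mulmx_sumr summxE.
move=> /neq0_sum[i]; rewrite bmulZl -scalemxAr mxE mulf_eq0 => /norP[/Px Pi].
rewrite (eigenvector_decomposition y dD) bmul_sumr mulmx_sumr summxE.
move=> /neq0_sum[j]; rewrite bmulZr -scalemxAr mxE mulf_eq0 => /norP[/Qy Qj] nz.
apply: (PQR i j l) => //; apply: (mulIf nz); rewrite -UD derD.
rewrite !(diagonalizes_eigen _ dD) bmulZl bmulZr -scalerDl.
by rewrite -scalemxAr mxE.
Qed.

Lemma eigsum_trichotomy U d D (v : vec) : diagonalizes U d D ->
  exists x y z, [/\ Aplus D x, Azero D y, Aminus D z & v = x + y + z].
Proof.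
move=> dD; have [UU _ dR UD] := dD.
pose part (P : pred 'I_n) : vec := U^H *m \col_i (if P i then (U *m v) i 0 else 0).
have partE P i : (U *m part P) i 0 = if P i then (U *m v) i 0 else 0.
  by rewrite /part mulmxA UU mul1mx mxE.
exists (part (fun i => 0 < d i)), (part (fun i => d i == 0)), (part (fun i => d i < 0)).
split.
- by apply/(eigsumP _ _ dD) => i; rewrite partE; case: ifP => //; rewrite eqxx.
- by apply/(eigsumP _ _ dD) => i; rewrite partE; case: ifP => [/eqP //|]; rewrite eqxx.
- by apply/(eigsumP _ _ dD) => i; rewrite partE; case: ifP => //; rewrite eqxx.
apply: (coord_inj dD) => i; rewrite !mulmxDr ![(_ + _ : 'cV__) i 0]mxE !partE.
by case: (real_ltgt0P (dR i)) => _; rewrite ?addr0 ?add0r.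
Qed.

Lemma Aplus_Aminus_eq0 U d D (v : vec) : diagonalizes U d D ->
  Aplus D v -> Aminus D v -> v = 0.
Proof.
move=> dD /(eigsumP _ _ dD) vp /(eigsumP _ _ dD) vm; apply: (coord_inj dD) => i.
rewrite mulmx0 [RHS]mxE; apply: contraTeq (isT : true) => nz.
by have := lt_trans (vp i nz) (vm i nz); rewrite ltxx.
Qed.

Lemma Azero_kernel U d D (v : vec) : diagonalizes U d D -> Azero D v <-> D *m v = 0.
Proof.
move=> dD; have [_ _ _ UD] := dD; split=> [/(eigsumP _ _ dD) v0|Dv].
  apply: (coord_inj dD) => i; rewrite UD mulmx0 [RHS]mxE.
  by case: (eqVneq ((U *m v) i 0) 0) => [->|/v0 ->]; rewrite ?mulr0 ?mul0r.
apply/(eigsumP _ _ dD) => i nz; have := UD v i; rewrite Dv mulmx0 mxE.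
by move/esym/eqP; rewrite mulf_eq0 (negbTE nz) orbF => /eqP.
Qed.


(** * Nilpotency and the radical *)

(* Degrees are measured by the number of smaller eigenvalues rather than by
   size, since [C] need not be archimedean. *)
Lemma Aplus_filtration U d D : diagonalizes U d D -> is_derivation mu D ->
  exists F : nat -> vec -> Prop,
    [/\ forall k, subspace (F k), forall x, Aplus D x -> F 0%N x,
        forall k x, F k x -> Aplus D x,
        forall k x y, F k x -> Aplus D y -> F k.+1 (bmul mu x y) &
        forall x, F n x -> x = 0].
Proof.
move=> dD derD; have [_ _ dR _] := dD.
pose height (a : C) := #|[pred j | d j < a]|.
exists (fun k => eigsum D (fun a => 0 < a /\ (k <= height a)%N)); split.
- by move=> k; apply: (eigsum_subspace _ dD).
- by move=> x /(eigsumP _ _ dD) xP; apply/(eigsumP _ _ dD) => i /xP.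
- by move=> k x /(eigsumP _ _ dD) xP; apply/(eigsumP _ _ dD) => i /xP[].
- move=> k x y; apply: (eigsum_mul dD derD) => i j l [di_gt0 ki] dj_gt0 ->.
  split; first exact: addr_gt0.
  (* Adding [d j > 0] keeps every eigenvalue below [d i] and adds [d i] itself, so the height
     grows. *)
  have lt_dij : d i < d i + d j by rewrite ltrDl.
  apply: leq_ltn_trans ki _; apply/proper_card/properP; split.
    by apply/subsetP => k'; rewrite !inE => /lt_trans; apply.
  by exists i; rewrite !inE ?ltxx.
(* No eigenvalue lies below itself, so every height is less than [n]. *)
move=> x /(eigsumP _ _ dD) xP; apply: (coord_inj dD) => i; rewrite mulmx0 [RHS]mxE.
apply/eqP/negPn/negP => /xP[_]; apply/negP; rewrite -ltnNge -[X in (_ < X)%N]card_ord.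
by apply/proper_card/properP; split; [apply/subsetP | exists i; rewrite ?inE ?ltxx].
Qed.

Lemma foldl_bmul_assoc (x y : vec) (s : seq vec) : associative_bilin mu ->
  foldl (bmul mu) (bmul mu x y) s = bmul mu x (foldl (bmul mu) y s).
Proof. by move=> assoc; elim: s y => //= z s IHs y; rewrite assoc IHs. Qed.

(** The ideal generated by a central subspace [P]: one left factor suffices, as [b (a w) = (b a) w]
    and [(a w) b = (a b) w]. *)
Inductive ideal_span (P : vec -> Prop) : vec -> Prop :=
| ideal_span_gen w of P w : ideal_span P w
| ideal_span_mul a w of P w : ideal_span P (bmul mu a w)
| ideal_span_add x y of ideal_span P x & ideal_span P y : ideal_span P (x + y).

Lemma ideal_span_ideal (P : vec -> Prop) : associative_bilin mu ->
  subspace P -> (forall w, P w -> in_center mu w) -> ideal mu (ideal_span P).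
Proof.
move=> assoc [P0 PD PZ] Pcent; split.
  split=> [||a x]; [exact: ideal_span_gen | exact: ideal_span_add |].
  elim=> [w Pw|b w Pw|u v _ IHu _ IHv].
  - exact/ideal_span_gen/PZ.
  - by rewrite -bmulZr; apply/ideal_span_mul/PZ.
  by rewrite scalerDr; apply: ideal_span_add.
move=> x y; elim=> [w Pw|a w Pw|u v _ [IHu IHu'] _ [IHv IHv']].
- by rewrite (Pcent w Pw x); split; apply: ideal_span_mul.
- rewrite -assoc; split; first exact: ideal_span_mul.
  by rewrite assoc (Pcent w Pw) -assoc; apply: ideal_span_mul.
by rewrite bmulDr bmulDl; split; apply: ideal_span_add.
Qed.

(** Central generators slide past other factors, [w (b v) = b (w v)], so products of generators
    control products in the ideals. *)
Lemma ideal_span_prod (P Q R : vec -> Prop) : associative_bilin mu ->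
  subspace P -> subspace Q -> subspace R ->
  (forall w, P w -> in_center mu w) -> (forall w, R w -> in_center mu w) ->
  (forall x y, P x -> Q y -> R (bmul mu x y)) ->
  forall x y, ideal_span P x -> ideal_span Q y -> ideal_span R (bmul mu x y).
Proof.
move=> assoc sP sQ sR Pcent Rcent PQR x y Px Qy.
have [_ Rid] := ideal_span_ideal assoc sR Rcent.
have PR w : P w -> ideal_span R (bmul mu w y).
  move=> Pw; elim: Qy => [v Qv|a v Qv|u v _ IHu _ IHv].
  - exact/ideal_span_gen/PQR.
  - rewrite -assoc (Pcent w Pw) assoc; apply: ideal_span_mul; exact: PQR.
  by rewrite bmulDr; apply: ideal_span_add.
elim: Px => [w /PR //|a w /PR Rwy|u v _ IHu _ IHv].
  by rewrite assoc; have [] := Rid a _ Rwy.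
by rewrite bmulDl; apply: ideal_span_add.
Qed.

Lemma ideal_span_eq0 (P : vec -> Prop) : (forall w, P w -> w = 0) ->
  forall x, ideal_span P x -> x = 0.
Proof.
move=> P0 x; elim=> [w /P0 //|a w /P0 ->|u v _ -> _ ->]; first exact: bmul0r.
exact: addr0.
Qed.

(* [J = A+ + K] with [K] the ideal generated by the central space [A-]: modulo [K]
   the algebra has nonnegative degrees, so a long product of elements of [J]
   falls into [K], and a long product of elements of [K] vanishes. *)
Lemma Aplus_Aminus_radical U d D (N : vec -> Prop) :
  diagonalizes U d D -> is_derivation mu D -> associative_bilin mu ->
  (forall x, Aminus D x -> in_center mu x) -> is_radical mu N ->
  (forall x, Aplus D x -> N x) /\ (forall x, Aminus D x -> N x).
Proof.
move=> dD derD assoc Acent [_ Nmax].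
(* The filtration for the derivation [- D] handles [Aminus D]. *)
have derN : is_derivation mu (- D).
  by move=> x y; rewrite !mulNmx derD opprD -!scaleN1r bmulZl bmulZr.
have dN := diagonalizes_opp dD.
have AmN x : Aplus (- D) x <-> Aminus D x.
  split=> [/(eigsumP _ _ dN)|/(eigsumP _ _ dD)] xP.
    by apply/(eigsumP _ _ dD) => i /xP; rewrite oppr_gt0.
  by apply/(eigsumP _ _ dN) => i /xP; rewrite oppr_gt0.
have [F [sF F0 FA FM Fn]] := Aplus_filtration dD derD.
have [G [sG G0 GA GM Gn]] := Aplus_filtration dN derN.
have Gcent k x : G k x -> in_center mu x by move=> /GA/AmN/Acent.
pose K k : vec -> Prop := ideal_span (G k).
have Kid k : ideal mu (K k) by exact: (ideal_span_ideal assoc (sG k) (Gcent k)).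
have KM k x y : K k x -> K 0%N y -> K k.+1 (bmul mu x y).
  apply: (ideal_span_prod assoc (sG k) (sG 0%N) (sG k.+1) (Gcent k) (Gcent k.+1)).
  by move=> u v Gu /GA; apply: GM.
have Kn x : K n x -> x = 0 by exact: ideal_span_eq0.
(* Only the [Aplus] part is filtered; the central part stays in [K 0]. *)
pose J k x := exists u v, [/\ F k u, K 0%N v & x = u + v].
have [[K00 K0D K0Z] K0M] := Kid 0%N.
have sJ k : subspace (J k).
  have [Fk0 FkD FkZ] := sF k; split.
  - by exists 0, 0; rewrite addr0.
  - move=> _ _ [u [v [Fu Kv ->]]] [u' [v' [Fu' Kv' ->]]].
    by exists (u + u'), (v + v'); split; [exact: FkD | exact: K0D | rewrite addrACA].
  - move=> a _ [u [v [Fu Kv ->]]]; exists (a *: u), (a *: v).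
    by split; [exact: FkZ | exact: K0Z | rewrite scalerDr].
have KJ k x : K 0%N x -> J k x.
  by move=> Kx; exists 0, x; rewrite add0r; split=> //; have [] := sF k.
have JM k x y : J k x -> J 0%N y -> J k.+1 (bmul mu x y).
  move=> [u [v [Fu Kv ->]]] [u' [v' [Fu' Kv' ->]]].
  rewrite bmulDl bmulDr -addrA.
  exists (bmul mu u u'), (bmul mu u v' + bmul mu v (u' + v')); split=> //.
    by apply: FM => //; exact: FA Fu'.
  by apply: K0D; [have [] := K0M u _ Kv' | have [] := K0M (u' + v') _ Kv].
have AM x y : Aplus D x -> Azero D y -> Aplus D (bmul mu x y) /\ Aplus D (bmul mu y x).
  move=> Ax Ay; split; [move: Ax Ay | move: Ay Ax];
    apply: (eigsum_mul dD derD) => i j l.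
    by move=> di dj ->; rewrite dj addr0.
  by move=> di dj ->; rewrite di add0r.
have AA x y : Aplus D x -> Aplus D y -> Aplus D (bmul mu x y).
  by move=> /F0 Fx Ay; apply: FA (FM _ _ _ Fx Ay).
(* For [u] in [Aplus D], multiplying by the positive and zero parts of [y] stays in [Aplus D]; the
   negative part of [y] lies in [K 0]. *)
have Jid : ideal mu (J 0%N).
  have [J00 J0D J0Z] := sJ 0%N.
  split=> [//|y _ [u [v [/FA Au Kv ->]]]].
  have [y1 [y2 [y3 [A1 A2 /AmN/G0 A3 ->]]]] := eigsum_trichotomy y dD.
  have JA x : Aplus D x -> J 0%N x.
    by move=> Ax; exists x, 0; rewrite addr0; split=> //; apply: F0.
  have [Kyv Kvy] := K0M (y1 + y2 + y3) _ Kv.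
  have [Ku3 K3u] := K0M u _ (ideal_span_gen A3).
  have [A2u Au2] := AM _ _ Au A2.
  split; rewrite ?[bmul mu (u + v) _]bmulDl ?[bmul mu _ (u + v)]bmulDr.
    apply: (J0D _ _ _ (KJ _ _ Kyv)); rewrite !bmulDl.
    by apply: (J0D _ _ _ (KJ _ _ K3u)); apply: J0D; apply: JA => //; exact: AA.
  apply: (J0D _ _ _ (KJ _ _ Kvy)); rewrite !bmulDr.
  by apply: (J0D _ _ _ (KJ _ _ Ku3)); apply: J0D; apply: JA => //; exact: AA.
have Jlong k x s : size s = k -> J 0%N x -> (forall y, y \in s -> J 0%N y) ->
    J k (foldl (bmul mu) x s).
  elim/last_ind: s k => [|s y IHs] [|k]; rewrite ?size_rcons // => -[sk] Jx Js.
  rewrite foldl_rcons; apply: JM; last by apply: Js; rewrite mem_rcons mem_head.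
  by apply: IHs => // z sz; apply: Js; rewrite mem_rcons in_cons sz orbT.
have Jn x s : size s = n -> J 0%N x -> (forall y, y \in s -> J 0%N y) ->
    K 0%N (foldl (bmul mu) x s).
  by move=> sn Jx Js; have [u [v [/Fn -> Kv ->]]] := Jlong n x s sn Jx Js; rewrite add0r.
(* The initial [x] and [n] factors give an element of [K 0]; each further block of [n.+1] factors is
   again in [K 0] and raises the degree by one. *)
have Klong k x s : size s = (n + k * n.+1)%N -> J 0%N x ->
    (forall y, y \in s -> J 0%N y) -> K k (foldl (bmul mu) x s).
  elim: k s => [|k IHk] s; first by rewrite mul0n addn0; apply: Jn.
  rewrite -(cat_take_drop (n + k * n.+1) s) size_cat => ss Jx Js.
  have st : size (take (n + k * n.+1) s) = (n + k * n.+1)%N.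
    by apply: size_takel; move: ss; rewrite -size_cat cat_take_drop => ->; lia.
  have sd : size (drop (n + k * n.+1) s) = n.+1 by move: ss; rewrite st; lia.
  have Jt y : y \in take (n + k * n.+1) s -> J 0%N y.
    by move=> ys; apply: Js; rewrite mem_cat ys.
  have Jd y : y \in drop (n + k * n.+1) s -> J 0%N y.
    by move=> ys; apply: Js; rewrite mem_cat ys orbT.
  rewrite foldl_cat; move: (IHk _ st Jx Jt) sd Jd.
  case: (drop _ s) => //= y t Kx [tn] Jyt; rewrite foldl_bmul_assoc //.
  apply: KM => //; apply: Jn => //; first by apply: Jyt; rewrite mem_head.
  by move=> z zt; apply: Jyt; rewrite in_cons zt orbT.
have NJ : forall x, J 0%N x -> N x.
  apply: Nmax; split=> //; exists (n + n * n.+1)%N => x s ss Jx Js.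
  by apply: Kn; apply: Klong.
split=> x Ax; apply: NJ.
  by exists x, 0; rewrite addr0; split=> //; apply: F0.
by apply/KJ/ideal_span_gen/G0/AmN.
Qed.


(** * Positivity of [D] on the annihilator *)

(** The sum is [x^H M x] in eigencoordinates. All [L_i] and [R_i] kill [x], leaving only the
    nonnegative terms [L_i L_i^H]. *)
Lemma ann_quadratic_ge0 U d D c (x : vec) :
  diagonalizes U d D -> Mmu mu = c%:M + D -> in_ann mu x ->
  0 <= \sum_i (c + d i) * `|(U *m x) i 0| ^+ 2.
Proof.
move=> [_ UU' _ UD] Mc annx.
have -> : \sum_i (c + d i) * `|(U *m x) i 0| ^+ 2 = \tr (x^H *m (Mmu mu *m x)).
  have -> : x^H = (U *m x)^H *m U by rewrite ctmxM -mulmxA UU' mulmx1.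
  rewrite -mulmxA Mc mulmxDl mul_scalar_mx.
  rewrite mulmxDr -scalemxAr mxtrace_mulC; apply: eq_bigr => i _.
  have -> : (c + d i) * `|(U *m x) i 0| ^+ 2 =
      (c *: (U *m x) + U *m (D *m x)) i 0 * ((U *m x) i 0)^*.
    rewrite [X in _ = X * _]mxE [X in _ = (X + _) * _]mxE UD -mulrDl normCK.
    by rewrite mulrA.
  by rewrite [RHS]mxE big_ord1 ctmxE.
rewrite /Mmu !mulmxBl !mulmxBr -!scalemxAl -!scalemxAr !mulmx_suml !mulmx_sumr.
rewrite [X in _ - _ *: X]big1 => [|i _]; last first.
  by rewrite -!mulmxA Rop_mul (annx _).1 !mulmx0.
rewrite [X in _ - _ *: X - _]big1 => [|i _]; last first.
  by rewrite -!mulmxA Lop_mul (annx _).2 !mulmx0.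
rewrite scaler0 !subr0 linearZ linear_sum mulr_ge0 //=; apply: sumr_ge0 => i _.
rewrite adjmE !mulmxA -[in X in _ *m X](ctmxK x) -mulmxA -ctmxM.
exact: mxtrace_mul_ctmx_ge0.
Qed.

(** The annihilator is [D]-invariant, so the nonpositive part of [x] can be isolated in it; there
    [c + d i < 0], against the nonnegative form. *)
Lemma ann_Aplus U d D c (x : vec) :
  diagonalizes U d D -> is_derivation mu D -> Mmu mu = c%:M + D -> c < 0 ->
  in_ann mu x -> Aplus D x.
Proof.
move=> dD derD Mc c_lt0 annx; have [_ _ dR UD] := dD.
(* Applies the product of the [D - d j] over [j] in [r]; with [r] the positive eigenvalues this
   erases exactly the positive coordinates. *)
pose kill (r : seq 'I_n) := foldr (fun j v => D *m v - d j *: v) x r.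
have kill_ann r : in_ann mu (kill r).
  elim: r => //= j r IHr y; have [ry yr] := IHr y.
  rewrite -scaleNr bmulDl bmulDr bmulZl bmulZr ry yr !scaler0 !addr0.
  have [rDy Dyr] := IHr (D *m y); have := derD (kill r) y; have := derD y (kill r).
  by rewrite ry yr rDy Dyr mulmx0 addr0 add0r.
have killE r i : (U *m kill r) i 0 = (\prod_(j <- r) (d i - d j)) * (U *m x) i 0.
  elim: r => [|j r IHr] /=; first by rewrite big_nil mul1r.
  rewrite mulmxBr -scalemxAr mxE [X in _ + X]mxE [X in - X]mxE UD IHr big_cons.
  by rewrite -mulrBl mulrA.
pose r := [seq j <- enum 'I_n | 0 < d j].
have kill_pos i : 0 < d i -> (U *m kill r) i 0 = 0.
  move=> di; rewrite killE (big_rem i) /= ?subrr ?mul0r //.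
  by rewrite mem_filter di mem_enum.
have := ann_quadratic_ge0 dD Mc (kill_ann r).
set q := \sum_i _ => q_ge0.
have q_le0 i : (c + d i) * `|(U *m kill r) i 0| ^+ 2 <= 0.
  case: (real_ltgt0P (dR i)) => di; first by rewrite kill_pos // normr0 expr0n mulr0.
    by rewrite nmulr_rle0 ?exprn_ge0 // -[0]addr0 ltrD.
  by rewrite di addr0 nmulr_rle0 ?exprn_ge0.
have q0 : \sum_i - ((c + d i) * `|(U *m kill r) i 0| ^+ 2) = 0.
  apply/eqP; rewrite eq_le sumr_ge0 => [|i _]; last by rewrite oppr_ge0.
  by rewrite sumrN oppr_le0 q_ge0.
apply/(eigsumP _ _ dD) => i xi; rewrite real_ltNge ?real0 //; apply/negP => di.
have cd : c + d i < 0 by rewrite -[0]addr0 ltr_leD.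
have : - ((c + d i) * `|(U *m kill r) i 0| ^+ 2) = 0.
  by apply: (psumr_eq0P _ q0) => // k _; rewrite oppr_ge0.
move/eqP; rewrite oppr_eq0 mulf_eq0 (lt_eqF cd) expf_eq0 normr_eq0 /= killE.
rewrite mulf_eq0 (negbTE xi) orbF prodf_seq_eq0 => /hasP[j].
rewrite mem_filter => /andP[dj _] /=; rewrite subr_eq0 => /eqP dij.
by move: dj; rewrite -dij => /lt_le_trans/(_ di); rewrite ltxx.
Qed.

(** * Orthogonal complements of ideals and reductivity *)

Lemma admx_sum (x : vec) : admx x = \sum_i x i 0 *: admx (evec C i).
Proof.
apply: eqmx_mulvec => v; rewrite admx_mul /lie {1 2}(vec_sum_evec x).
rewrite bmul_suml bmul_sumr -sumrB mulmx_suml; apply: eq_bigr => i _.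
by rewrite bmulZl bmulZr -scalemxAl admx_mul scalerBr.
Qed.

(** A subspace is an arbitrary predicate, so a spanning matrix is grown by adjoining missing
    vectors, by excluded middle, until the rank can rise no further. *)
Lemma subspace_rowspace (I : vec -> Prop) : subspace I ->
  exists B : 'M[C]_n, forall v, I v <-> (v^T <= B)%MS.
Proof.
move=> [I0 ID IZ].
suff grow k (B : 'M[C]_n) : (n - \rank B < k)%N -> (forall v, (v^T <= B)%MS -> I v) ->
    exists B' : 'M[C]_n, forall v, I v <-> (v^T <= B')%MS.
  apply: (grow n.+1 0); first by rewrite mxrank0 subn0.
  by move=> v; rewrite submx0 => /eqP/(congr1 trmx); rewrite trmxK trmx0 => ->.
elim: k B => // k IHk B rB BI.
have [[v [Iv vB]]|noI] := classic (exists v, I v /\ ~ (v^T <= B)%MS); last first.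
  exists B => v; split; last exact: BI.
  by move=> Iv; apply: NNPP => vB; apply: noI; exists v.
apply: (IHk (B + <<v^T>>)%MS).
  have : (B < B + <<v^T>>)%MS.
    rewrite ltmxE addsmxSl; apply/negP => sB; apply: vB; apply: submx_trans sB.
    by apply: submx_trans (addsmxSr _ _); rewrite genmxE.
  rewrite ltmxErank => /andP[_ lt].
  by have := rank_leq_col (B + <<v^T>>)%MS; lia.
move=> u /sub_addsmxP[[a b] /= uE].
have -> : u = (a *m B)^T + (b *m <<v^T>>%MS)^T by rewrite -linearD -uE /= trmxK.
apply: ID; first by apply: BI; rewrite trmxK submxMl.
have : (b *m <<v^T>> <= v^T)%MS by apply: submx_trans (submxMl _ _) _; rewrite genmxE.
by move=> /sub_rVP[z ->]; rewrite linearZ /= trmxK; apply: IZ.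
Qed.

(** If the rows of [S] are an orthonormal basis, [S^H *m S] projects row vectors; the transpose acts
    on columns. *)
Lemma orthogonal_projection (I : vec -> Prop) : subspace I ->
  exists p : 'M[C]_n, [/\ p^H = p, p *m p = p & forall v, I v <-> p *m v = v].
Proof.
move=> /subspace_rowspace[B IB].
have rn : (\rank B <= n)%N by exact: rank_leq_col.
have := schmidt_unitarymx (row_base B) rn; have := eqmx_schmidt_free (row_base_free B).
move: (schmidt _) => S SB /unitarymxP.
have -> : map_mx Num.conj S^T = S^H by apply/matrixP => i j; rewrite !mxE.
move=> SS; exists (S^H *m S)^T; split.
- have -> (A : 'M[C]_n) : (A^T)^H = (A^H)^T by apply/matrixP => i j; rewrite !mxE.
  by rewrite ctmxM ctmxK.
- by rewrite -trmx_mul mulmxA -(mulmxA S^H) SS mulmx1.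
move=> v; have -> : I v <-> (v^T <= S)%MS by rewrite IB SB eq_row_base.
split=> [/submxP[w vw]|<-].
  by apply: trmx_inj; rewrite trmx_mul trmxK vw mulmxA -(mulmxA w) SS mulmx1.
by rewrite trmx_mul trmxK mulmxA submxMl.
Qed.


(* With [p] the orthogonal projection onto an ideal [I] of the Lie algebra [Azero D],
   the functional [x |-> tr (p ad_x)] vanishes on brackets, hence is the inner
   product with some central [t].  For [h = ad_a^H a], [ad_h = [ad_a^H, ad_a]], the
   value at [h] is [-|p ad_a (1 - p)|^2] on one side and [<a, [a, t]> = 0] on the other:
   [ad_a] commutes with [p]. *)
Lemma ideal_projection_comm U d D (p : 'M[C]_n) (I : vec -> Prop) :
  diagonalizes U d D -> D^H = D -> is_derivation mu D -> associative_bilin mu ->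
  (forall A, Azero D A -> is_derivation mu (admx A)^H) ->
  lie_ideal (lie mu) (Azero D) I ->
  p^H = p -> p *m p = p -> (forall v, I v <-> p *m v = v) ->
  forall a, Azero D a -> p *m admx a = admx a *m p.
Proof.
move=> dD hD derD assoc adjder [_ Ig Iid] hp pp pI a ga.
have g0 v : Azero D v <-> D *m v = 0 := Azero_kernel v dD.
have adX x : Azero D x -> admx x *m p = p *m admx x *m p.
  move=> gx; apply: eqmx_mulvec => v; rewrite -!mulmxA; apply/esym/pI.
  by rewrite admx_mul; apply: Iid => //; apply/pI; rewrite mulmxA pp.
have Dp : D *m p = 0.
  apply: eqmx_mulvec => v; rewrite -mulmxA mul0mx; apply/g0/Ig/pI.
  by rewrite mulmxA pp.
have pD : p *m D = 0 by rewrite -hp -hD -ctmxM Dp ctmx0.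
pose chi x := \tr (p *m admx x).
pose t : vec := \col_i (chi (evec C i))^*.
have chiE x : (t^H *m x) 0 0 = chi x.
  rewrite /chi admx_sum mulmx_sumr linear_sum mxE; apply: eq_bigr => i _ /=.
  by rewrite ctmxE mxE conjCK mulrC -scalemxAr linearZ.
have chiD x : chi (D *m x) = 0.
  rewrite /chi -admx_bracket // mulmxBr !mulmxA pD mul0mx sub0r linearN /=.
  by rewrite mxtrace_mulC mulmxA Dp mul0mx mxtrace0 oppr0.
(* [|D t|^2] is the value of [chi] at [D (D t)], hence zero. *)
have gt : Azero D t.
  apply/g0/ctmx_mul_eq0/matrixP => i j; rewrite !ord1 ctmxM hD -mulmxA chiE.
  by rewrite chiD mxE.
have trpXY x y : Azero D x -> Azero D y ->
    \tr (p *m admx x *m admx y) = \tr (admx x *m p *m (admx y *m p)).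
  move=> gx gy; rewrite -{1}pp -!mulmxA mxtrace_mulC !mulmxA.
  by rewrite -[p *m _ *m admx y *m p]mulmxA (adX y gy) !mulmxA -(adX x gx).
(* On the ideal, [chi] is the trace of the restricted adjoint action, so it kills commutators. *)
have chi_lie x y : Azero D x -> Azero D y -> chi (lie mu x y) = 0.
  move=> gx gy; rewrite /chi -admx_mul -admx_bracket; last exact: admx_derivation.
  rewrite mulmxBr linearB /= !mulmxA !trpXY // [X in _ - X]mxtrace_mulC.
  exact: subrr.
have adD x : Azero D x -> D *m admx x = admx x *m D.
  move=> /g0 Dx; apply/eqP; rewrite -subr_eq0 admx_bracket // Dx.
  by rewrite admx_sum big1 // => i _; rewrite mxE scale0r.
pose E := (admx a)^H.
have derE : is_derivation mu E by exact: adjder.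
have gE x : Azero D x -> Azero D (E *m x).
  move=> /g0 Dx; apply/g0; rewrite mulmxA -hD -ctmxM -adD // ctmxM hD -mulmxA.
  by rewrite Dx mulmx0.
have EX x : E *m admx x - admx x *m E = admx (E *m x) by exact: admx_bracket.
(* With [E a] and [E t] in [Azero D], [|[a, t]|^2 = chi [E a, t] + chi [a, E t] = 0]. *)
have ad_t : admx a *m t = 0.
  apply/ctmx_mul_eq0/matrixP => i j; rewrite !ord1 ctmxM -/E [RHS]mxE.
  rewrite -mulmxA (mulmxA E) -[E *m admx a](subrK (admx a *m E)) EX.
  rewrite mulmxDl mulmxDr mxE -mulmxA !admx_mul !chiE !chi_lie ?addr0 //;
    by apply: gE.
have chiEa : chi (E *m a) = 0 by rewrite -chiE mulmxA -ctmxM ad_t ctmx0 mul0mx mxE.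
have pE : p *m E = p *m E *m p.
  by have := congr1 (@ctmx C n n) (adX a ga); rewrite !ctmxM hp mulmxA.
(* The squared norm of [p ad_a (1 - p)] reduces to [- chi (E a)]. *)
have pXp : p *m admx a - p *m admx a *m p = 0.
  apply: mxtrace_mul_ctmx_eq0; rewrite ctmxB !ctmxM hp -/E.
  have -> (X : 'M[C]_n) : (p *m X - p *m X *m p) *m (E *m p - p *m (E *m p)) =
      p *m X *m E *m p - p *m X *m p *m E.
    rewrite mulmxA -pE mulmxBl !mulmxBr -!mulmxA (mulmxA p p) pp.
    by rewrite (mulmxA p E p) -pE subrr subr0.
  rewrite -adX // linearB /= mxtrace_mulC !mulmxA pp.
  rewrite -[admx a *m p *m E]mulmxA [X in _ - X]mxtrace_mulC.
  rewrite -[p *m admx a *m E]mulmxA -[p *m E *m admx a]mulmxA -linearB /=.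
  rewrite -mulmxBr -opprB EX mulmxN linearN /=; apply/eqP.
  by rewrite oppr_eq0; apply/eqP.
by apply/eqP; rewrite adX // -subr_eq0 pXp.
Qed.

(** The complement of an ideal is the kernel of its orthogonal projection [p] in [Azero D], stable
    because [p] commutes with every [ad_a]. *)
Lemma Azero_reductive U d D :
  diagonalizes U d D -> D^H = D -> is_derivation mu D -> associative_bilin mu ->
  (forall A, Azero D A -> is_derivation mu (admx A)^H) ->
  reductive_lie (lie mu) (Azero D).
Proof.
move=> dD hD derD assoc adjder.
have g0 v : Azero D v <-> D *m v = 0 := Azero_kernel v dD.
have g_lie a b : Azero D a -> Azero D b -> Azero D (lie mu a b).
  move=> /g0 Da /g0 Db; apply/g0; rewrite /lie mulmxBr !derD Da Db.
  by rewrite !bmul0l !bmul0r addr0 subrr.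
have sg := eigsum_subspace (fun a => a = 0) dD.
split=> // I idI; have [sI Ig Iid] := idI.
have [p [hp pp pI]] := orthogonal_projection sI.
have pX := ideal_projection_comm dD hD derD assoc adjder idI hp pp pI.
have Ip v : I (p *m v) by apply/pI; rewrite mulmxA pp.
have [g00 gD gZ] := sg.
exists (fun v => Azero D v /\ p *m v = 0); split.
- split=> [|v [] //|a x ga [gx px]]; last first.
    by split; [exact: g_lie | rewrite -admx_mul mulmxA pX // -mulmxA px mulmx0].
  split=> [|x y [gx px] [gy py]|a x [gx px]]; first by rewrite mulmx0.
    by split; [exact: gD | rewrite mulmxDr px py addr0].
  by split; [exact: gZ | rewrite -scalemxAr px scaler0].
- by move=> v /pI vI [_ pv]; rewrite -vI.
move=> v gv; exists (p *m v), (v - p *m v); split=> //; last by rewrite addrC subrK.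
split; last by rewrite mulmxBr mulmxA pp subrr.
by apply: gD => //; rewrite -scaleN1r; apply/gZ/Ig.
Qed.

End Algebra.

(** * Deduction of the four assertions *)

Theorem theorem4p10 (C : numClosedFieldType) (n : nat) (mu : bilin C n)
    (c : C) (D : 'M[C]_n) :
  bilin_nonzero mu -> associative_bilin mu ->
  c \is Num.real -> is_derivation mu D -> Mmu mu = c%:M + D ->
  [/\ (* (i) *) (forall x, in_ann mu x -> Aplus D x),
      (* (ii) *) (forall N, is_radical mu N -> forall x, Aplus D x -> N x),
      (* (iii) *) (forall x, Aminus D x ->
                     in_center mu x /\ forall N, is_radical mu N -> N x)
                  /\ (forall x, Aminus D x -> in_ann mu x -> x = 0)
    & (* (iv) *) (forall A, Azero D A -> is_derivation mu (adjm (Lop mu A - Rop mu A)))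
                 /\ reductive_lie (lie mu) (Azero D)].
Proof.
move=> mu_neq0 assoc c_real derD Mc.
have hD : D^H = D.
  have -> : D = Mmu mu - c%:M by rewrite Mc addrC addKr.
  by rewrite ctmxB Mmu_hermitian ctmx_scalar conj_Creal.
have [U [d dD]] := hermitian_diagonalizes hD.
have c_lt0 := Mmu_scalar_lt0 mu_neq0 derD Mc.
have ad_eigen l x : D *m x = l *: x -> D *m admx mu x - admx mu x *m D = l *: admx mu x.
  move=> Dx; rewrite admx_bracket // Dx; apply: eqmx_mulvec => v.
  by rewrite -scalemxAl !admx_mul /lie bmulZl bmulZr scalerBr.
have ad_key l x (Dx : D *m x = l *: x) :=
  eigen_derivation (admx_derivation x assoc) Mc (ad_eigen l x Dx).
have Acent x : Aminus D x -> in_center mu x.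
  move=> [k [a [w [aw ->]]]] y; rewrite bmul_suml bmul_sumr; apply: eq_bigr => i _.
  have [ai Dw] := aw i; have [tr_ge0 _] := ad_key _ _ Dw.
  (* A negative eigenvalue times [|ad|^2] is nonnegative, so [ad] vanishes on each eigenvector of
     the sum. *)
  apply/eqP; rewrite -subr_eq0 -[_ - _]admx_mul.
  rewrite (@mxtrace_mul_ctmx_eq0 _ _ _ (admx mu (w i))) ?mul0mx //.
  apply/eqP; rewrite eq_le mxtrace_mul_ctmx_ge0 andbT.
  by rewrite -(nmulr_rge0 _ ai).
have annA := ann_Aplus dD derD Mc c_lt0.
have adjder A : Azero D A -> is_derivation mu (admx mu A)^H.
  move=> /(Azero_kernel _ dD) DA.
  have [_] := ad_key 0 A (etrans DA (esym (scale0r A))).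
  by apply.
have radA N rN := Aplus_Aminus_radical dD derD assoc Acent (N := N) rN.
split=> [x|N /radA[] //||]; first exact: annA.
- split=> x Ax; last by move=> /annA Ap; exact: Aplus_Aminus_eq0 dD Ap Ax.
  by split; [exact: Acent | move=> N /radA[_]; apply].
by split; [exact: adjder | exact: Azero_reductive dD hD derD assoc adjder].
Qed.
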